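(* The gap-tooth scheme (defined in the context), applied to the constant coefficient diffusion equation $\frac{\partial}{\partial t}u(x,t)=a^*\frac{\partial^2}{\partial x^2}u(x,t)$ with exact, analytical integration within the boxes, and with boundary conditions for the boxes defined through interpolating polynomials of (even) order $k$, is equivalent to a finite difference discretization of the same diffusion equation with order $k$ central differences in space and an explicit Euler time step.
   Context: The diffusion equation, with constant diffusion coefficient $a^*$, is posed for $x\in[0,1]$. Take an equidistant macroscopic mesh $0=x_0<x_1=x_0+\Delta x<\dots<x_N=1$, and around each mesh point $x_i$ a small box (tooth) $[x_i-\frac h2,x_i+\frac h2]$ of length $h\ll\Delta x$. The unknowns of the gap-tooth scheme are the box averages $U_i^n$, where $U_i^n$ is the average over the box around $x_i$ at time $t_n$. Let $k$ be even. One step of the scheme, from $t_n$ to $t_{n+1}=t_n+\Delta t$, maps the box averages $U_i^n$ to $U_i^{n+1}$ as follows. (1) Boundary conditions. In box $i$ the profile is approximated by a polynomial $p_i^k(x;t_n)$ of degree $k$ having the given box averages in box $i$ and in the $\frac k2$ boxes to the left and to the right: $$\frac1h\int_{x_{i+j}-h/2}^{x_{i+j}+h/2}p_i^k(\xi;t_n)\,\mathrm d\xi=U_{i+j}^n,\qquad j=-\tfrac k2,\dots,\tfrac k2.$$ Its slopes at the ends of the box, $s_i^\pm=\frac{\mathrm d}{\mathrm dx}p_i^k(x;t_n)\big|_{x=x_i\pm h/2}$, are used as Neumann boundary conditions, held fixed during the time $\Delta t$. (2) Initial condition. In box $i$ the initial condition at time $t_n$ is the quadratic polynomial $\tilde u^i(x,t_n)=a(x-x_i)^2+b(x-x_i)+c$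 that has slopes $s_i^\pm$ at $x_i\pm\frac h2$ and average $U_i^n$ over the box, that is, $$a=\frac{s_i^+-s_i^-}{2h},\qquad b=\frac{s_i^++s_i^-}{2},\qquad c=U_i^n-\frac h{24}(s_i^+-s_i^-).$$ (3) Time integration. In each box, $\tilde u^i(x,t)$ is obtained by solving the diffusion equation from $t_n$ to $t_{n+1}$ with this initial condition and these Neumann boundary conditions. ''Exact, analytical integration'' means that this initial-boundary value problem in the box is solved exactly. (4) Restriction. $U_i^{n+1}=\frac1h\int_{x_i-h/2}^{x_i+h/2}\tilde u^i(\xi,t_{n+1})\,\mathrm d\xi$ is the box average at time $t_{n+1}$. *)

(* Defs.v *)
From Stdlib Require Import Reals ZArith.
From Coquelicot Require Import Coquelicot.
Open Scope R_scope.

Definition mesh (dx : R) (i : Z) : R := IZR i * dx.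

Definition box_average (h x : R) (v : R -> R) : R :=
  / h * RInt v (x - h / 2) (x + h / 2).

(* [sum_n] includes its upper bound, so this is a polynomial of degree at
   most [k]. *)
Definition polynomial_of_degree (k : nat) (p : R -> R) : Prop :=
  exists coef : nat -> R, forall x, p x = sum_n (fun l => coef l * x ^ l) k.

(* For even [k], the integers [stencil k l] with [0 <= l <= k] run through
   [-k/2, ..., k/2]. *)
Definition stencil (k l : nat) : Z := (Z.of_nat l - Z.of_nat (k / 2))%Z.

Definition interpolates_averages
    (k : nat) (h dx : R) (V : Z -> R) (i : Z) (p : R -> R) : Prop :=
  polynomial_of_degree k p /\
  forall l : nat, (l <= k)%nat ->
    box_average h (mesh dx (i + stencil k l)) p = V (i + stencil k l)%Z.

Definition initial_profile (h x0 v sm sp x : R) : R :=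
  (sp - sm) / (2 * h) * (x - x0) ^ 2 + (sp + sm) / 2 * (x - x0)
  + (v - h / 24 * (sp - sm)).

Definition closed_rectangle (l r t0 t1 : R) (z : R * R) : Prop :=
  l <= fst z <= r /\ t0 <= snd z <= t1.

Definition open_rectangle (l r t0 t1 : R) (z : R * R) : Prop :=
  l < fst z < r /\ t0 < snd z < t1.

(* Classical solution [u] on [[l, r] x [t0, t1]] of the diffusion equation with
   initial value [u0] and constant Neumann data [sl], [sr].  The functions
   [ux], [ut], [uxx] are the partial derivatives of [u]; [ux] is required to
   extend continuously to the lateral sides, where it therefore is the
   one-sided derivative of [u]. *)
Record neumann_solution (a l r t0 t1 sl sr : R) (u0 : R -> R)
    (u ux ut uxx : R -> R -> R) : Prop := {
  sol_cont : continuous_on (closed_rectangle l r t0 t1)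
    (fun z : R * R => u (fst z) (snd z));
  sol_ux_cont : continuous_on (closed_rectangle l r t0 t1)
    (fun z : R * R => ux (fst z) (snd z));
  sol_ut_cont : continuous_on (open_rectangle l r t0 t1)
    (fun z : R * R => ut (fst z) (snd z));
  sol_uxx_cont : continuous_on (open_rectangle l r t0 t1)
    (fun z : R * R => uxx (fst z) (snd z));
  sol_ux : forall x t, l < x < r -> t0 <= t <= t1 ->
    is_derive (fun y => u y t) x (ux x t);
  sol_ut : forall x t, l < x < r -> t0 < t < t1 ->
    is_derive (fun s => u x s) t (ut x t);
  sol_uxx : forall x t, l < x < r -> t0 < t < t1 ->
    is_derive (fun y => ux y t) x (uxx x t);
  sol_pde : forall x t, l < x < r -> t0 < t < t1 -> ut x t = a * uxx x t;
  sol_left : forall t, t0 <= t <= t1 -> ux l t = sl;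
  sol_right : forall t, t0 <= t <= t1 -> ux r t = sr;
  sol_init : forall x, l <= x <= r -> u x t0 = u0 x
}.

(* [U n i] is the average over box [i] at time [n * dt]. *)
Definition gap_tooth_update
    (k : nat) (a h dx dt : R) (U : nat -> Z -> R) (n : nat) (i : Z) : Prop :=
  let xl := mesh dx i - h / 2 in
  let xr := mesh dx i + h / 2 in
  let t0 := INR n * dt in
  let t1 := INR (S n) * dt in
  exists p : R -> R,
    interpolates_averages k h dx (U n) i p /\
    let sm := Derive p xl in
    let sp := Derive p xr in
    exists u ux ut uxx : R -> R -> R,
      neumann_solution a xl xr t0 t1 sm sp
        (initial_profile h (mesh dx i) (U n i) sm sp) u ux ut uxx /\
      U (S n) i = box_average h (mesh dx i) (fun x => u x t1).

Definition smooth (f : R -> R) : Prop :=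
  forall (m : nat) (x : R), ex_derive_n f m x.

Definition central_difference (k : nat) (c : Z -> R) (d : R) (v : Z -> R) (i : Z)
    : R :=
  / d ^ 2 * sum_n (fun l => c (stencil k l) * v (i + stencil k l)%Z) k.

(* The weights [c j], [-k/2 <= j <= k/2], form the order [k] central difference
   for the second derivative: centred stencil of [k + 1] points, truncation
   error [O(d ^ k)].  These conditions determine [c] on the stencil; its values
   elsewhere play no role. *)
Definition order_central_weights (k : nat) (c : Z -> R) : Prop :=
  forall f : R -> R, smooth f -> forall x : R,
  exists C delta : R, 0 < delta /\
    forall d : R, 0 < d < delta ->
      Rabs (central_difference k c d (fun j => f (x + IZR j * d)) 0
            - Derive_n f 2 x) <= C * d ^ k.

Definition euler_central_update
    (k : nat) (c : Z -> R) (a dx dt : R) (U : nat -> Z -> R) (n : nat) (i : Z)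
    : Prop :=
  U (S n) i = U n i + dt * (a * central_difference k c dx (U n) i).

(* Main.v *)
(* Averaging a polynomial [p] over boxes of length [h] gives a polynomial [P] of
   the same degree, and this map is bijective, because it fixes the leading
   coefficient.  So [P] is the Lagrange interpolant of the box averages, and
   [(p'(x_i + h/2) - p'(x_i - h/2)) / h], the average of [p''] over the box, is
   [P''(x_i)], which is the order [k] central difference of the averages.  On the
   other side, by conservation of mass, an exact solution with fixed Neumann data
   changes its box average at the constant rate [a (s^+ - s^-) / h], whence the
   explicit Euler step. *)
Require Import Defs.
From Stdlib Require Import Reals ZArith Lra Lia.
From Coquelicot Require Import Coquelicot.
Open Scope R_scope.

(** * Sums, integrals and polynomial functions *)

(** The weights are known only through an asymptotic truncation error on smooth functions, whereas
    the scheme runs at one fixed width [dx]. The bridge is exactness: on a polynomial of degree at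
    most [k] the error, scaled by [d ^ 2], is itself a polynomial in the width [d], and it is too
    small near 0 to be anything but 0. For the existence of weights, [k + 1] unknowns can be matched
    to the moments of order 0 to [k], but an error [O(d ^ k)] after division by [d ^ 2] calls for
    the moment of order [k + 1] as well. This is where the evenness of [k] enters, through a
    symmetric stencil. The new box average is computed for an arbitrary interpolant and an arbitrary
    solution, so the passage from Euler to gap-tooth only has to exhibit one of each. *)

Lemma sum_n_R_ext (f g : nat -> R) (n : nat) :
  (forall l, (l <= n)%nat -> f l = g l) -> sum_n f n = sum_n g n.
Proof. exact (sum_n_ext_loc f g n). Qed.

(** This and the similar restatements below carry the operations of [R] instead of those of an
    abstract structure, so that [ring], [lra] and rewriting apply. *)
Lemma sum_n_R_S (f : nat -> R) (n : nat) : sum_n f (S n) = sum_n f n + f (S n).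
Proof. now rewrite sum_Sn. Qed.

Lemma sum_n_R_head (f : nat -> R) (n : nat) :
  sum_n f (S n) = f 0%nat + sum_n (fun l => f (S l)) n.
Proof.
  unfold sum_n; rewrite (sum_Sn_m f 0 (S n)) by lia.
  now rewrite <- (sum_n_m_S f 0 n).
Qed.

Lemma sum_n_R_plus (f g : nat -> R) (n : nat) :
  sum_n (fun l => f l + g l) n = sum_n f n + sum_n g n.
Proof. exact (sum_n_plus f g n). Qed.

Lemma sum_n_R_scal (c : R) (f : nat -> R) (n : nat) :
  sum_n (fun l => c * f l) n = c * sum_n f n.
Proof. exact (sum_n_mult_l c f n). Qed.

Lemma sum_n_R_rev (f : nat -> R) (n : nat) :
  sum_n (fun l => f (n - l)%nat) n = sum_n f n.
Proof.
  revert f; induction n as [|n IH]; intros f.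
  - now rewrite !sum_O.
  - rewrite sum_n_R_S, Nat.sub_diag.
    rewrite (sum_n_R_ext _ (fun l => f (S (n - l)))).
    2:{ intros l Hl; f_equal; lia. }
    rewrite (IH (fun l => f (S l))).
    rewrite sum_n_R_head; apply Rplus_comm.
Qed.

Lemma RInt_R_ext (f g : R -> R) (a b : R) :
  (forall x, Rmin a b < x < Rmax a b -> f x = g x) -> RInt f a b = RInt g a b.
Proof. exact (RInt_ext f g a b). Qed.

Lemma RInt_R_plus (f g : R -> R) (a b : R) :
  ex_RInt f a b -> ex_RInt g a b ->
  RInt (fun x => f x + g x) a b = RInt f a b + RInt g a b.
Proof. exact (RInt_plus f g a b). Qed.

Lemma RInt_R_scal (c : R) (f : R -> R) (a b : R) :
  ex_RInt f a b -> RInt (fun x => c * f x) a b = c * RInt f a b.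
Proof. exact (RInt_scal f a b c). Qed.

Lemma RInt_R_const (c a b : R) : RInt (fun _ => c) a b = (b - a) * c.
Proof. exact (RInt_const a b c). Qed.

(* Polynomial functions with at most [n] coefficients, that is, of degree
   less than [n], in Horner form. *)
Fixpoint poly (n : nat) (p : R -> R) : Prop :=
  match n with
  | O => forall x, p x = 0
  | S m => exists c q, poly m q /\ forall x, p x = c + x * q x
  end.

Lemma poly_ext n p q : (forall x, p x = q x) -> poly n p -> poly n q.
Proof.
  destruct n as [|n]; simpl; intros E H.
  - intros x; now rewrite <- E.
  - destruct H as (c & r & Hr & H); exists c, r; split; [easy|].
    intros x; now rewrite <- E.
Qed.

Lemma poly_plus n p q : poly n p -> poly n q -> poly n (fun x => p x + q x).
Proof.
  revert p q; induction n as [|n IH]; simpl; intros p q Hp Hq.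
  - intros x; rewrite Hp, Hq; ring.
  - destruct Hp as (c & p' & Hp' & Hp), Hq as (d & q' & Hq' & Hq).
    exists (c + d), (fun x => p' x + q' x); split; [now apply IH|].
    intros x; rewrite Hp, Hq; ring.
Qed.

Lemma poly_scal n a p : poly n p -> poly n (fun x => a * p x).
Proof.
  revert p; induction n as [|n IH]; simpl; intros p Hp.
  - intros x; rewrite Hp; ring.
  - destruct Hp as (c & p' & Hp' & Hp).
    exists (a * c), (fun x => a * p' x); split; [now apply IH|].
    intros x; rewrite Hp; ring.
Qed.

Lemma poly_minus n p q : poly n p -> poly n q -> poly n (fun x => p x - q x).
Proof.
  intros Hp Hq.
  apply poly_ext with (fun x => p x + (-1) * q x); [intros x; ring|].
  apply poly_plus; [easy|now apply poly_scal].
Qed.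

Lemma poly_zero n : poly n (fun _ => 0).
Proof.
  induction n as [|n IH]; simpl; [easy|].
  exists 0, (fun _ => 0); split; [easy|intros x; ring].
Qed.

Lemma poly_const n c : poly (S n) (fun _ => c).
Proof.
  exists c, (fun _ => 0); split; [apply poly_zero|intros x; ring].
Qed.

Lemma poly_mono m n p : (m <= n)%nat -> poly m p -> poly n p.
Proof.
  revert n p; induction m as [|m IH]; simpl; intros n p Hmn Hp.
  - apply poly_ext with (fun _ => 0); [now intros x; rewrite Hp|apply poly_zero].
  - destruct n as [|n]; [lia|].
    destruct Hp as (c & p' & Hp' & Hp); exists c, p'; split; [|easy].
    apply IH; [lia|easy].
Qed.

Lemma poly_mult_X n p : poly n p -> poly (S n) (fun x => x * p x).
Proof. intros Hp; exists 0, p; split; [easy|intros x; ring]. Qed.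

Lemma poly_comp_affine n p a b : poly n p -> poly n (fun x => p (a + x * b)).
Proof.
  revert p; induction n as [|n IH]; intros p Hp.
  - now intros x; rewrite Hp.
  - destruct Hp as (c & q & Hq & Hp).
    apply poly_ext with
      (fun x => c + (a * q (a + x * b) + x * (b * q (a + x * b)))).
    { intros x; rewrite Hp; ring. }
    apply (poly_plus _ (fun _ => c)); [apply poly_const|].
    apply poly_plus.
    + apply (poly_mono n); [lia|]; now apply poly_scal, IH.
    + now apply poly_mult_X, poly_scal, IH.
Qed.

Lemma polynomial_of_degree_poly k p : polynomial_of_degree k p <-> poly (S k) p.
Proof.
  split.
  - intros (c & Hc); revert p c Hc.
    induction k as [|k IH]; intros p c Hc.
    + apply poly_ext with (fun _ => c 0%nat); [|apply poly_const].
      intros x; rewrite Hc, sum_O; ring.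
    + exists (c 0%nat), (fun x => sum_n (fun l => c (S l) * x ^ l) k); split.
      { now apply (IH _ (fun l => c (S l))). }
      intros x; rewrite Hc, <- sum_n_R_scal.
      rewrite sum_n_R_head, pow_O, Rmult_1_r; f_equal.
      apply sum_n_R_ext; intros l _; simpl; ring.
  - revert p; induction k as [|k IH]; intros p (c & q & Hq & Hp).
    + exists (fun _ => c); intros x; rewrite sum_O, Hp, Hq; ring.
    + destruct (IH q Hq) as (e & He).
      exists (fun l => match l with O => c | S m => e m end); intros x.
      rewrite Hp, He, <- sum_n_R_scal.
      rewrite sum_n_R_head, pow_O, Rmult_1_r; f_equal.
      apply sum_n_R_ext; intros l _; simpl; ring.
Qed.

Lemma poly_derive n p :
  poly n p -> exists dp, poly n dp /\ forall x, is_derive p x (dp x).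
Proof.
  revert p; induction n as [|n IH]; intros p Hp.
  - exists (fun _ => 0); split; [easy|]; intros x.
    apply is_derive_ext with (fun _ => 0); [now intros t; rewrite Hp|].
    apply @is_derive_const.
  - destruct Hp as (c & q & Hq & Hp); destruct (IH q Hq) as (dq & Hdq & Dq).
    exists (fun x => q x + x * dq x); split.
    + apply poly_plus; [apply (poly_mono n); [lia|easy]|now apply poly_mult_X].
    + intros x; apply is_derive_ext with (fun x => c + x * q x);
        [now intros t; rewrite Hp|].
      auto_derive; [now exists (dq x)|].
      replace (Derive _ x) with (dq x) by (symmetry; apply is_derive_unique, Dq).
      ring.
Qed.

Lemma poly_continuous n p x : poly n p -> continuous p x.
Proof.
  intros Hp; destruct (poly_derive n p Hp) as (dp & _ & D).
  apply @ex_derive_continuous; exists (dp x); apply D.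
Qed.

Lemma poly_ex_RInt n p a b : poly n p -> ex_RInt p a b.
Proof.
  intros Hp; apply @ex_RInt_continuous; intros x _; now apply (poly_continuous n).
Qed.

Lemma poly_Derive_n n p m :
  poly n p -> exists q, poly n q /\ forall x, Derive_n p m x = q x.
Proof.
  intros Hp; induction m as [|m IH].
  - now exists p.
  - destruct IH as (q & Hq & E); destruct (poly_derive n q Hq) as (dq & Hdq & D).
    exists dq; split; [easy|]; intros x; simpl.
    rewrite (Derive_ext _ q) by easy; apply is_derive_unique, D.
Qed.

Lemma poly_smooth n p : poly n p -> smooth p.
Proof.
  intros Hp [|m] x; simpl; [easy|].
  destruct (poly_Derive_n n p m Hp) as (q & Hq & E).
  destruct (poly_derive n q Hq) as (dq & _ & D).
  apply ex_derive_ext with q; [now intros t|]; exists (dq x); apply D.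
Qed.

Lemma poly_bounded n p a b :
  poly n p -> exists M, forall x, a <= x <= b -> Rabs (p x) <= M.
Proof.
  intros Hp; destruct (Rle_dec a b) as [Hab|Hab]; [|exists 0; intros; lra].
  destruct (continuity_ab_maj (fun x => Rabs (p x)) a b Hab) as (m & Hm & _).
  - intros c _; apply continuity_pt_filterlim.
    apply (continuous_comp p Rabs); [now apply (poly_continuous n)|].
    apply continuous_Rabs.
  - now exists (Rabs (p m)).
Qed.

(** Letting [d] tend to 0 kills the constant Horner coefficient [c]; dividing the bound by [d] then
    leaves the same claim for [q], with one coefficient fewer. *)
Lemma poly_small_eq_zero n p C delta :
  0 < delta -> poly n p ->
  (forall d, 0 < d < delta -> Rabs (p d) <= C * d ^ n) -> forall x, p x = 0.
Proof.
  intros Hd; revert p; induction n as [|n IH]; intros p Hp HC; [easy|].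
  destruct Hp as (c & q & Hq & Hp).
  destruct (poly_bounded n q 0 1 Hq) as (M & HM).
  assert (HC0 : forall d, 0 < d < Rmin delta 1 -> Rabs c <= (Rabs C + Rabs M) * d).
  { intros d [Hd1 Hd2].
    pose proof (Rmin_l delta 1); pose proof (Rmin_r delta 1).
    replace c with (p d + - (d * q d)) by (rewrite Hp; ring).
    eapply Rle_trans; [apply Rabs_triang|].
    rewrite Rabs_Ropp, Rabs_mult, (Rabs_pos_eq d) by lra.
    specialize (HC d ltac:(lra)); specialize (HM d ltac:(lra)).
    pose proof (Rle_abs C); pose proof (Rle_abs M).
    assert (0 <= d ^ n <= 1).
    { split; [apply pow_le; lra|].
      rewrite <- (pow1 n); apply pow_incr; lra. }
    assert (C * d ^ S n <= Rabs C * d).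
    { simpl; replace (C * (d * d ^ n)) with ((C * d) * d ^ n) by ring.
      pose proof (Rabs_pos C).
      apply Rle_trans with ((Rabs C * d) * d ^ n).
      - apply Rmult_le_compat_r; [easy|]; apply Rmult_le_compat_r; lra.
      - rewrite <- (Rmult_1_r (Rabs C * d)) at 2; apply Rmult_le_compat_l; nra. }
    nra. }
  assert (c = 0) as ->.
  { apply Rabs_eq_0, Rle_antisym; [|apply Rabs_pos].
    apply Rnot_lt_le; intros Hpos.
    (* The [+ 1] keeps [K] positive; a positive [d] below [Rabs c / K] contradicts [HC0]. *)
    set (K := Rabs C + Rabs M + 1).
    assert (1 <= K) by (unfold K; pose proof (Rabs_pos C); pose proof (Rabs_pos M); lra).
    set (d := Rmin (Rmin delta 1) (Rabs c / K) / 2).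
    assert (0 < Rmin delta 1) by (apply Rmin_pos; lra).
    assert (0 < Rabs c / K) by (apply Rdiv_lt_0_compat; lra).
    assert (0 < Rmin (Rmin delta 1) (Rabs c / K)) by (apply Rmin_pos; lra).
    pose proof (Rmin_l (Rmin delta 1) (Rabs c / K)).
    pose proof (Rmin_r (Rmin delta 1) (Rabs c / K)).
    specialize (HC0 d ltac:(unfold d; lra)).
    assert (K * d < Rabs c).
    { apply Rlt_le_trans with (K * (Rabs c / K)).
      - apply Rmult_lt_compat_l; unfold d; lra.
      - right; field; lra. }
    unfold K in *; unfold d in *; nra. }
  assert (Z : forall x, q x = 0).
  { apply IH; [easy|]; intros d H1; specialize (HC d H1).
    rewrite Hp, Rplus_0_l, Rabs_mult, (Rabs_pos_eq d) in HC by lra.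
    apply Rmult_le_reg_l with d; [lra|]; simpl in HC; lra. }
  intros x; rewrite Hp, Z; ring.
Qed.

(* [centred_moment 0] is the box average; the higher moments enter because
   averaging does not commute with the factors [x] of the Horner form. *)
Definition centred_moment (h : R) (j : nat) (p : R -> R) (x : R) : R :=
  / h * RInt (fun s => s ^ j * p (x + s)) (- (h / 2)) (h / 2).

Lemma centred_moment_0 h n p x :
  poly n p -> box_average h x p = centred_moment h 0 p x.
Proof.
  intros Hp; unfold box_average, centred_moment; f_equal.
  symmetry.
  replace (x - h / 2) with (1 * - (h / 2) + x) by ring.
  replace (x + h / 2) with (1 * (h / 2) + x) by ring.
  rewrite <- (RInt_comp_lin p 1 x) by now apply (poly_ex_RInt n).
  apply RInt_R_ext; intros s _; simpl.
  change scal with Rmult; f_equal; f_equal; ring.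
Qed.

Lemma centred_moment_integrable h j n p x :
  poly n p -> ex_RInt (fun s => s ^ j * p (x + s)) (- (h / 2)) (h / 2).
Proof.
  intros Hp; apply @ex_RInt_continuous; intros s _.
  apply (continuous_mult (fun s => s ^ j)).
  - apply @ex_derive_continuous; auto_derive; easy.
  - apply (continuous_comp (fun s => x + s) p); [|now apply (poly_continuous n)].
    apply @ex_derive_continuous; auto_derive; easy.
Qed.

(** In the factor [y = x + s], the part [x] leaves the integral and the part [s] raises the order of
    the moment. *)
Lemma centred_moment_horner h j c n q x :
  poly n q ->
  centred_moment h j (fun y => c + y * q y) x
  = c * (/ h * RInt (fun s => s ^ j) (- (h / 2)) (h / 2))
    + x * centred_moment h j q x + centred_moment h (S j) q x.
Proof.
  intros Hq; unfold centred_moment.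
  assert (H1 : ex_RInt (fun s => s ^ j) (- (h / 2)) (h / 2)).
  { apply @ex_RInt_continuous; intros s _; apply @ex_derive_continuous.
    auto_derive; easy. }
  pose proof (centred_moment_integrable h j n q x Hq) as H2.
  pose proof (centred_moment_integrable h (S j) n q x Hq) as H3.
  rewrite (RInt_R_ext _ (fun s =>
    c * s ^ j + (x * (s ^ j * q (x + s)) + s ^ S j * q (x + s)))).
  2:{ intros s _; simpl; ring. }
  assert (H4 : ex_RInt (fun s => x * (s ^ j * q (x + s))) (- (h / 2)) (h / 2))
    by exact (ex_RInt_scal _ _ _ x H2).
  rewrite (RInt_R_plus (fun s => c * s ^ j));
    [|exact (ex_RInt_scal _ _ _ c H1)|exact (ex_RInt_plus _ _ _ _ H4 H3)].
  rewrite (RInt_R_plus (fun s => x * (s ^ j * q (x + s)))) by easy.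
  rewrite (RInt_R_scal c), (RInt_R_scal x) by easy; ring.
Qed.

Lemma centred_moment_ext h j p q x :
  (forall y, p y = q y) -> centred_moment h j p x = centred_moment h j q x.
Proof.
  intros E; unfold centred_moment; f_equal; apply RInt_R_ext; intros s _.
  now rewrite E.
Qed.

(** The induction has to cover all [j] at once, since the Horner recursion passes from order [j] to
    order [j + 1]. *)
Lemma poly_centred_moment h j n p : poly n p -> poly n (centred_moment h j p).
Proof.
  revert j p; induction n as [|n IH]; intros j p Hp.
  - intros x; unfold centred_moment.
    rewrite (RInt_R_ext _ (fun _ => 0)) by (intros s _; rewrite Hp; ring).
    rewrite RInt_R_const; ring.
  - destruct Hp as (c & q & Hq & Hp).
    eapply poly_ext.
    { intros x; symmetry; rewrite (centred_moment_ext h j _ _ x Hp).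
      rewrite (centred_moment_horner h j c n q x Hq); reflexivity. }
    apply poly_plus.
    + apply (poly_plus _ (fun _ => _)); [apply poly_const|].
      now apply poly_mult_X, IH.
    + apply (poly_mono n); [lia|now apply IH].
Qed.

(** Averaging preserves constants, so [c] cancels and the defect of [c + x * q] is [x] times the
    defect of [q], minus the first moment of [q]; neither term has more coefficients than [q]. *)
Lemma poly_centred_moment_defect h n p :
  h <> 0 -> poly (S n) p -> poly n (fun x => p x - centred_moment h 0 p x).
Proof.
  intros Hh; revert p; induction n as [|n IH]; intros p (c & q & Hq & Hp).
  - assert (E : forall x, p x - centred_moment h 0 p x =
      x * (q x - centred_moment h 0 q x) - centred_moment h 1 q x).
    { intros x; rewrite (centred_moment_ext h 0 _ _ x Hp), Hp.
      rewrite (centred_moment_horner h 0 c _ q x Hq).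
      rewrite (RInt_R_ext _ (fun _ => 1)) by easy.
      rewrite RInt_R_const; field; easy. }
    intros x; rewrite E, Hq.
    rewrite !(poly_centred_moment h _ 0 q Hq x); ring.
  - eapply poly_ext.
    { intros x; symmetry.
      rewrite (centred_moment_ext h 0 _ _ x Hp), Hp.
      rewrite (centred_moment_horner h 0 c _ q x Hq).
      rewrite (RInt_R_ext _ (fun _ => 1)) by easy.
      rewrite RInt_R_const.
      instantiate (1 := fun x =>
        x * (q x - centred_moment h 0 q x) - centred_moment h 1 q x).
      simpl; field; easy. }
    apply poly_minus.
    + now apply poly_mult_X, IH.
    + now apply poly_centred_moment.
Qed.

(** Correct [q] by a preimage [r] of its defect, which exists by induction because the defect has
    one coefficient fewer: the average of [q + r] is the average of [q] plus the defect, that is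
    [q]. *)
Lemma centred_moment_surjective h n q :
  h <> 0 -> poly n q ->
  exists p, poly n p /\ forall x, centred_moment h 0 p x = q x.
Proof.
  intros Hh; revert q; induction n as [|n IH]; intros q Hq.
  - exists (fun _ => 0); split; [easy|]; intros x; rewrite Hq.
    now apply (poly_centred_moment h 0 0 (fun _ => 0)).
  - destruct (IH _ (poly_centred_moment_defect h n q Hh Hq)) as (r & Hr & E).
    exists (fun x => q x + r x); split.
    { apply poly_plus; [easy|apply (poly_mono n); [lia|easy]]. }
    intros x.
    transitivity (centred_moment h 0 q x + centred_moment h 0 r x);
      [|rewrite E; ring].
    unfold centred_moment; rewrite <- Rmult_plus_distr_l; f_equal.
    rewrite <- RInt_R_plus; [|eapply centred_moment_integrable; eauto ..].
    apply RInt_R_ext; intros s _; ring.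
Qed.

(** Newton's construction: [p] is [v n + (x - y n) * q x], where [q] interpolates the divided
    differences with respect to the node [y n]. *)
Lemma interpolation (n : nat) (y v : nat -> R) :
  (forall l m, (l < m < n)%nat -> y l <> y m) ->
  exists p, poly n p /\ forall l, (l < n)%nat -> p (y l) = v l.
Proof.
  revert v; induction n as [|n IH]; intros v Hy.
  - exists (fun _ => 0); split; [easy|lia].
  - destruct (IH (fun l => (v l - v n) / (y l - y n))) as (q & Hq & E).
    { intros l m Hl; apply Hy; lia. }
    exists (fun x => v n + (x * q x - y n * q x)); split.
    + apply (poly_plus _ (fun _ => v n)); [apply poly_const|].
      apply poly_minus; [now apply poly_mult_X|].
      apply (poly_mono n); [lia|now apply poly_scal].
    + intros l Hl; destruct (Nat.eq_dec l n) as [->|Hn]; [ring|].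
      rewrite E by lia; field.
      apply Rminus_eq_contra, Hy; lia.
Qed.

(* Subtracting [y n] times each equation from the next one eliminates the
   last unknown from all equations but the first. *)
Lemma dual_vandermonde (n : nat) (y b : nat -> R) :
  (forall l m, (l < m <= n)%nat -> y l <> y m) ->
  exists w : nat -> R, forall m, (m <= n)%nat ->
    sum_n (fun l => w l * y l ^ m) n = b m.
Proof.
  revert b; induction n as [|n IH]; intros b Hy.
  - exists (fun _ => b 0%nat); intros m Hm; replace m with 0%nat by lia.
    rewrite sum_O; simpl; ring.
  - destruct (IH (fun m => b (S m) - y (S n) * b m)) as (w & Hw).
    { intros l m Hl; apply Hy; lia. }
    (* The elimination multiplies the weight at [y l] by [y l - y (S n)], which is undone here; the
       equation for [m = 0] then fixes the last weight [w0]. *)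
    set (w' := fun l => w l / (y l - y (S n))).
    set (w0 := b 0%nat - sum_n w' n).
    exists (fun l => if Nat.eq_dec l (S n) then w0 else w' l).
    assert (E : forall m, sum_n (fun l =>
        (if Nat.eq_dec l (S n) then w0 else w' l) * y l ^ m) (S n)
      = sum_n (fun l => w' l * y l ^ m) n + w0 * y (S n) ^ m).
    { intros m; rewrite sum_n_R_S; f_equal.
      - apply sum_n_R_ext; intros l Hl.
        destruct (Nat.eq_dec l (S n)); [lia|easy].
      - now destruct (Nat.eq_dec (S n) (S n)). }
    intros m Hm; rewrite E; clear E; induction m as [|m IHm].
    + rewrite (sum_n_R_ext _ w') by (intros l _; simpl; ring).
      unfold w0; simpl; ring.
    + specialize (IHm ltac:(lia)); specialize (Hw m ltac:(lia)).
      rewrite (sum_n_R_ext _ (fun l =>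
        w l * y l ^ m + y (S n) * (w' l * y l ^ m))).
      * rewrite sum_n_R_plus, sum_n_R_scal; simpl pow; nra.
      * intros l Hl; unfold w'; simpl; field.
        apply Rminus_eq_contra, Hy; lia.
Qed.

(** * Central difference weights *)

(** A Taylor estimate without the factorial: [G m] is the [m]-th derivative of [G 0], and each use
    of the mean value theorem on a function vanishing at 0 gains one factor [d]. *)
Lemma derivative_chain_bound (n : nat) (G : nat -> R -> R) (C : R) :
  (forall m x, is_derive (G m) x (G (S m) x)) ->
  (forall m, (m < n)%nat -> G m 0 = 0) ->
  (forall d, 0 <= d <= 1 -> Rabs (G n d) <= C) ->
  forall d, 0 <= d <= 1 -> Rabs (G 0%nat d) <= C * d ^ n.
Proof.
  revert G; induction n as [|n IH]; intros G HD H0 HC d Hd.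
  - rewrite pow_O, Rmult_1_r; now apply HC.
  - assert (IH' : forall z, 0 <= z <= 1 -> Rabs (G 1%nat z) <= C * z ^ n).
    { apply (IH (fun m => G (S m))); [easy| |easy].
      intros m Hm; apply H0; lia. }
    destruct (MVT_gen (G 0%nat) 0 d (G 1%nat)) as (z & Hz & E).
    + intros; apply HD.
    + intros x _; apply continuity_pt_filterlim, @ex_derive_continuous.
      exists (G 1%nat x); apply HD.
    + rewrite Rmin_left, Rmax_right in Hz by lra.
      rewrite (H0 0%nat) in E by lia.
      replace (G 0%nat d) with (G 1%nat z * d) by lra.
      rewrite Rabs_mult, (Rabs_pos_eq d) by lra.
      assert (0 <= C).
      { eapply Rle_trans; [apply Rabs_pos|apply (HC 0); lra]. }
      replace (C * d ^ S n) with (C * d ^ n * d) by (simpl; ring).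
      apply Rmult_le_compat_r; [lra|].
      eapply Rle_trans; [apply IH'; lra|].
      apply Rmult_le_compat_l; [easy|]; apply pow_incr; lra.
Qed.

(** The second derivative of [x ^ m] at 0. *)
Definition second_derivative_moment (m : nat) : R :=
  if Nat.eq_dec m 2 then 2 else 0.

(* With [G 0 d] equal to [d ^ 2] times the truncation error, the moment
   conditions make the derivatives of [G 0] of order up to [k + 1] vanish at
   [0]. *)
Lemma order_central_weights_of_moments (k : nat) (c : Z -> R) :
  (forall m, (m <= k + 1)%nat ->
    sum_n (fun l => c (stencil k l) * IZR (stencil k l) ^ m) k
    = second_derivative_moment m) ->
  order_central_weights k c.
Proof.
  intros M f Hf x.
  set (D := Derive_n f 2 x).
  (* [q m] is the [m]-th derivative in [d] of [d ^ 2 * D], which makes [G (S m)] the derivative of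
     [G m]. *)
  set (q := fun m d =>
    match m with O => d ^ 2 * D | 1 => 2 * d * D | 2 => 2 * D | _ => 0 end).
  set (G := fun m d => sum_n (fun l =>
    c (stencil k l) * IZR (stencil k l) ^ m
    * Derive_n f m (x + IZR (stencil k l) * d)) k - q m d).
  assert (HD : forall m d, is_derive (G m) d (G (S m) d)).
  { intros m d; apply @is_derive_minus.
    - apply @is_derive_sum_n; intros l _.
      auto_derive; [exact (Hf (S m) _)|].
      change (fun x => Derive_n f m x) with (Derive_n f m); simpl; ring.
    - destruct m as [|[|[|m]]]; unfold q; auto_derive; trivial; ring. }
  assert (H0 : forall m, (m < k + 2)%nat -> G m 0 = 0).
  { intros m Hm; unfold G.
    rewrite (sum_n_R_ext _ (fun l => Derive_n f m x *
      (c (stencil k l) * IZR (stencil k l) ^ m))).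
    2:{ intros l _; rewrite Rmult_0_r, Rplus_0_r; apply Rmult_comm. }
    rewrite sum_n_R_scal, M by lia.
    destruct m as [|[|[|m]]]; unfold q, second_derivative_moment, D; simpl; ring. }
  destruct (continuity_ab_maj (fun d => Rabs (G (k + 2)%nat d)) 0 1)
    as (z & Hz & _).
  { lra. }
  { intros d _; apply continuity_pt_filterlim.
    apply (continuous_comp (G (k + 2)%nat) Rabs); [|apply continuous_Rabs].
    apply @ex_derive_continuous; eexists; apply HD. }
  exists (Rabs (G (k + 2)%nat z)), 1; split; [lra|]; intros d Hd.
  pose proof (derivative_chain_bound _ G _ HD H0 Hz d ltac:(lra)) as B.
  replace (central_difference _ _ _ _ _ - Derive_n f 2 x)
    with (/ d ^ 2 * G 0%nat d).
  - rewrite Rabs_mult, Rabs_pos_eq.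
    2:{ left; apply Rinv_0_lt_compat, pow_lt; lra. }
    apply Rmult_le_reg_l with (d ^ 2); [apply pow_lt; lra|].
    rewrite <- Rmult_assoc, Rinv_r, Rmult_1_l by (apply pow_nonzero; lra).
    rewrite pow_add in B; lra.
  - unfold central_difference, G, q; fold D.
    rewrite Rmult_minus_distr_l; f_equal; [f_equal|field; lra].
    apply sum_n_R_ext; intros l _; simpl; f_equal; ring.
Qed.

Lemma stencil_injective k l m : stencil k l = stencil k m -> l = m.
Proof. unfold stencil; lia. Qed.

Lemma stencil_sub k l :
  Nat.Even k -> (l <= k)%nat -> stencil k (k - l) = (- stencil k l)%Z.
Proof.
  intros (j & ->) Hl; unfold stencil.
  rewrite Nat.mul_comm, Nat.div_mul by lia; lia.
Qed.

(* Symmetrizing the weights kills the moment of the odd order [k + 1]. *)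
Lemma order_central_weights_exist (k : nat) :
  Nat.Even k -> exists c, order_central_weights k c.
Proof.
  intros Hk.
  destruct (dual_vandermonde k (fun l => IZR (stencil k l))
    second_derivative_moment) as (w & Hw).
  { intros l m Hl E; apply eq_IZR, stencil_injective in E; lia. }
  (* Passes from positions [l] to offsets [j]; [Z.to_nat] truncates only to the left of the stencil,
     which for even [k] is invariant under [j -> - j]. *)
  set (e := fun j => w (Z.to_nat (j + Z.of_nat (k / 2)))).
  assert (Ee : forall l, e (stencil k l) = w l).
  { intros l; unfold e, stencil; f_equal; lia. }
  exists (fun j => / 2 * (e j + e (- j)%Z)).
  apply order_central_weights_of_moments; intros m Hm.
  set (S := sum_n (fun l => w l * IZR (stencil k l) ^ m) k).
  assert (E : sum_n (fun l => e (- stencil k l)%Z * IZR (stencil k l) ^ m) k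
    = (-1) ^ m * S).
  { rewrite <- sum_n_R_rev; unfold S; rewrite <- sum_n_R_scal.
    apply sum_n_R_ext; intros l Hl.
    rewrite stencil_sub, Z.opp_involutive, Ee, opp_IZR by easy.
    replace (- IZR (stencil k l)) with (-1 * IZR (stencil k l)) by ring.
    rewrite Rpow_mult_distr; simpl; ring. }
  assert (F : / 2 * (S + (-1) ^ m * S) = second_derivative_moment m).
  { destruct (Nat.eq_dec m (k + 1)) as [->|Hmk].
    - destruct Hk as (j & ->).
      rewrite Nat.add_1_r, pow_1_odd; unfold second_derivative_moment.
      destruct (Nat.eq_dec _ 2); [lia|ring].
    (* The only nonzero moment has the even order 2, and symmetrizing leaves even moments
       unchanged. *)
    - unfold S; rewrite Hw by lia; unfold second_derivative_moment.
      destruct (Nat.eq_dec m 2) as [->|_]; simpl; field. }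
  rewrite <- F, <- E; unfold S; rewrite <- sum_n_R_plus, <- sum_n_R_scal.
  apply sum_n_R_ext; intros l _; rewrite Ee; simpl; ring.
Qed.

Lemma poly_sum_n n (f : nat -> R -> R) k :
  (forall l, (l <= k)%nat -> poly n (f l)) ->
  poly n (fun x => sum_n (fun l => f l x) k).
Proof.
  induction k as [|k IH]; intros H.
  - apply poly_ext with (f 0%nat); [intros x; now rewrite sum_O|apply H; lia].
  - apply poly_ext with (fun x => sum_n (fun l => f l x) k + f (S k) x).
    { intros x; now rewrite sum_n_R_S. }
    apply poly_plus; [apply IH; intros; apply H; lia|apply H; lia].
Qed.

(* As a function of the mesh width [d], the error times [d ^ 2] is a polynomial
   of degree at most [k] and is [O(d ^ (k + 2))], so it vanishes. *)
Lemma order_central_weights_exact (k : nat) (c : Z -> R) (g : R -> R) :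
  Nat.Even k -> order_central_weights k c -> poly (S k) g ->
  sum_n (fun l => c (stencil k l) * g (IZR (stencil k l))) k = Derive_n g 2 0.
Proof.
  intros Hk Hc Hg.
  destruct (Hc g (poly_smooth _ g Hg) 0) as (C & delta & Hd & HC).
  set (E := fun d =>
    sum_n (fun l => c (stencil k l) * g (0 + d * IZR (stencil k l))) k
    - d * (d * Derive_n g 2 0)).
  assert (HE : poly (S k) E).
  { apply poly_minus.
    - apply (poly_sum_n _ (fun l d => _)); intros l _.
      now apply (poly_scal _ _ (fun d => _)), poly_comp_affine.
    - destruct k as [|k].
      (* For [k = 0] the quadratic term would exceed the degree, but [g] is constant and its second
         derivative is 0. *)
      + destruct Hg as (a & q & Hq & Hg).
        apply poly_ext with (fun _ => 0); [|apply poly_zero]; intros d.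
        rewrite (Derive_n_ext _ (fun _ => a)) by (intros t; rewrite Hg, Hq; ring).
        rewrite Derive_n_const; ring.
      + apply (poly_mono 3); [destruct Hk; lia|].
        apply poly_mult_X, poly_mult_X, poly_const. }
  (* The bound of order [d ^ (k + 2)] is weakened to the exponent [k + 1], the number of
     coefficients of [E]; this takes [d < 1] and the nonnegative constant [Rabs C]. *)
  assert (Z : forall d, E d = 0).
  { apply (poly_small_eq_zero (S k) E (Rabs C) (Rmin delta 1)); [|easy|].
    - apply Rmin_pos; lra.
    - intros d Hd1.
      pose proof (Rmin_l delta 1); pose proof (Rmin_r delta 1).
      replace (E d) with (d ^ 2 * (central_difference k c d
        (fun j => g (0 + IZR j * d)) 0 - Derive_n g 2 0)).
      + rewrite Rabs_mult, (Rabs_pos_eq (d ^ 2)) by (apply pow_le; lra).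
        specialize (HC d ltac:(lra)).
        assert (0 < d ^ k) by (apply pow_lt; lra).
        assert (C * d ^ k <= Rabs C * d ^ k)
          by (apply Rmult_le_compat_r; [lra|apply Rle_abs]).
        apply Rle_trans with (d ^ 2 * (Rabs C * d ^ k)).
        * apply Rmult_le_compat_l; [apply pow_le; lra|lra].
        * pose proof (Rabs_pos C); simpl.
          assert (0 <= Rabs C * d ^ k) by nra.
          assert (d * d <= d) by nra.
          replace (Rabs C * (d * d ^ k)) with (d * (Rabs C * d ^ k)) by ring.
          apply Rmult_le_compat_r; lra.
      + unfold central_difference, E.
        rewrite Rmult_minus_distr_l, <- Rmult_assoc, Rinv_r, Rmult_1_l
          by (apply pow_nonzero; lra).
        f_equal; [|ring].
        apply sum_n_R_ext; intros l _; f_equal; simpl; f_equal; ring. }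
  specialize (Z 1); unfold E in Z.
  rewrite (sum_n_R_ext _ (fun l => c (stencil k l) * g (IZR (stencil k l)))) in Z.
  - lra.
  - intros l _; f_equal; f_equal; ring.
Qed.

(** * Conservation of mass *)

(** For [a <= b], the projection onto [[a, b]]. Composing with it in both variables extends a
    function continuous on the closed rectangle to one continuous on the whole plane, as
    [continuity_2d_pt] requires at boundary points. *)
Definition clamp (a b x : R) : R := Rmax a (Rmin b x).

Lemma clamp_bounds a b x : a <= b -> a <= clamp a b x <= b.
Proof.
  intros H; unfold clamp, Rmax, Rmin.
  repeat destruct (Rle_dec _ _); lra.
Qed.

Lemma clamp_id a b x : a <= x <= b -> clamp a b x = x.
Proof.
  intros H; unfold clamp, Rmax, Rmin.
  repeat destruct (Rle_dec _ _); lra.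
Qed.

Lemma clamp_contract a b x y : Rabs (clamp a b x - clamp a b y) <= Rabs (x - y).
Proof.
  unfold clamp, Rmax, Rmin, Rabs.
  repeat destruct (Rle_dec _ _); repeat destruct (Rcase_abs _); lra.
Qed.

Lemma continuity_2d_pt_clamp (F : R -> R -> R) l r t0 t1 x t :
  l <= r -> t0 <= t1 ->
  continuous_on (closed_rectangle l r t0 t1) (fun z => F (fst z) (snd z)) ->
  continuity_2d_pt (fun y s => F (clamp l r y) (clamp t0 t1 s)) x t.
Proof.
  intros Hlr Ht HF eps.
  assert (HD : forall y s, closed_rectangle l r t0 t1 (clamp l r y, clamp t0 t1 s)).
  { intros y s; split; simpl; now apply clamp_bounds. }
  destruct (HF _ (HD x t) (ball (F (clamp l r x) (clamp t0 t1 t)) eps)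
    (locally_ball _ eps)) as (delta & Hdelta).
  exists delta; intros y s Hy Hs.
  apply (Hdelta (clamp l r y, clamp t0 t1 s)); [|apply HD].
  split; simpl; (eapply Rle_lt_trans; [apply clamp_contract|easy]).
Qed.

Lemma continuity_2d_pt_open_rectangle (F : R -> R -> R) l r t0 t1 x t :
  continuous_on (open_rectangle l r t0 t1) (fun z => F (fst z) (snd z)) ->
  l < x < r -> t0 < t < t1 -> continuity_2d_pt F x t.
Proof.
  intros HF Hx Ht eps.
  destruct (HF (x, t) (conj Hx Ht) (ball (F x t) eps) (locally_ball _ eps))
    as (delta & Hdelta).
  assert (Hm : 0 < Rmin delta (Rmin (Rmin (x - l) (r - x)) (Rmin (t - t0) (t1 - t)))).
  { repeat apply Rmin_pos; try lra; apply cond_pos. }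
  exists (mkposreal _ Hm); simpl; intros y s Hy Hs.
  apply (Hdelta (y, s)).
  - split; (eapply Rlt_le_trans; [eassumption|apply Rmin_l]).
  - revert Hy Hs; unfold Rmin; repeat destruct (Rle_dec _ _); intros Hy Hs;
      apply Rabs_def2 in Hy, Hs; split; simpl; lra.
Qed.

Lemma continuity_2d_pt_continuous_1 (F : R -> R -> R) x t :
  continuity_2d_pt F x t -> continuous (fun y => F y t) x.
Proof.
  intros HF; apply continuity_pt_filterlim.
  intros eps Heps; destruct (HF (mkposreal eps Heps)) as (delta & H).
  exists delta; split; [apply cond_pos|]; intros y [_ Hy]; apply H.
  - exact Hy.
  - rewrite Rminus_diag, Rabs_R0; apply cond_pos.
Qed.

(** Uniform continuity on [[a, b] x [t - 1, t + 1]] bounds the change of the integrand by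
    [eps / (b - a + 1)], where [+ 1] covers the case [a = b]. *)
Lemma RInt_param_continuous (F : R -> R -> R) a b t :
  (forall x s, continuity_2d_pt F x s) ->
  a <= b -> continuous (fun s => RInt (fun x => F x s) a b) t.
Proof.
  intros HF Hab; apply continuity_pt_filterlim; intros eps Heps.
  assert (Hint : forall s, ex_RInt (fun x => F x s) a b).
  { intros s; apply @ex_RInt_continuous; intros x _.
    now apply continuity_2d_pt_continuous_1. }
  assert (Heps' : 0 < eps / (b - a + 1)) by (apply Rdiv_lt_0_compat; lra).
  destruct (uniform_continuity_2d F a b (t - 1) (t + 1)
    (fun x s _ _ => HF x s) (mkposreal _ Heps')) as (delta & Hdelta).
  exists (Rmin delta 1); split; [apply Rmin_pos; [apply cond_pos|lra]|].
  intros s [_ Hs]; simpl in *; unfold Rdist in *.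
  pose proof (Rmin_l delta 1); pose proof (Rmin_r delta 1).
  assert (Hst : Rabs (s - t) < 1) by lra; apply Rabs_def2 in Hst.
  replace (RInt (fun x => F x s) a b - RInt (fun x => F x t) a b)
    with (RInt (fun x => F x s - F x t) a b).
  2:{ exact (RInt_minus (fun x => F x s) (fun x => F x t) a b (Hint s) (Hint t)). }
  apply Rle_lt_trans with ((b - a) * (eps / (b - a + 1))).
  - apply abs_RInt_le_const; [easy| |].
    + exact (ex_RInt_minus (fun x => F x s) (fun x => F x t) a b (Hint s) (Hint t)).
    + intros x Hx; left; apply Hdelta; try lra.
      rewrite Rminus_diag, Rabs_R0; apply cond_pos.
  - apply Rlt_le_trans with ((b - a + 1) * (eps / (b - a + 1))).
    + apply Rmult_lt_compat_r; lra.
    + right; field; lra.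
Qed.

(** As [[x1, x2]] lies inside the open box, one may differentiate under the integral; the equation
    replaces [ut] by [a * uxx], and the fundamental theorem of calculus gives the fluxes. *)
Lemma neumann_interior_flux a l r t0 t1 sl sr u0 u ux ut uxx x1 x2 t :
  neumann_solution a l r t0 t1 sl sr u0 u ux ut uxx ->
  l < x1 -> x1 <= x2 -> x2 < r -> t0 < t < t1 ->
  is_derive (fun s => RInt (fun x => u x s) x1 x2) t (a * (ux x2 t - ux x1 t)).
Proof.
  intros [_ _ Cut Cuxx Dux Dut Duxx Heat _ _ _] Hx1 H12 Hx2 Ht.
  assert (Hmm : forall x, Rmin x1 x2 <= x <= Rmax x1 x2 -> l < x < r).
  { intros x; rewrite Rmin_left, Rmax_right by lra; lra. }
  assert (Hloc : forall P : R -> Prop, (forall s, t0 < s < t1 -> P s) -> locally t P).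
  { intros P HP; apply (locally_interval _ t t0 t1); simpl; try lra.
    intros s; simpl; intros; apply HP; lra. }
  assert (Hint : RInt (fun x => a * uxx x t) x1 x2 = a * (ux x2 t - ux x1 t)).
  { assert (H : is_RInt (fun x => uxx x t) x1 x2 (ux x2 t - ux x1 t)).
    { apply (is_RInt_derive (fun x => ux x t)).
      - intros x Hx; apply Duxx; [now apply Hmm|easy].
      - intros x Hx; apply continuity_2d_pt_continuous_1.
        eapply continuity_2d_pt_open_rectangle; eauto. }
    rewrite RInt_R_scal; [|eexists; apply H].
    f_equal; now apply is_RInt_unique. }
  rewrite <- Hint, (RInt_R_ext _ (fun x => Derive (fun s => u x s) t)).
  2:{ intros x Hx; symmetry; apply is_derive_unique.
      rewrite <- Heat by (try apply Hmm; lra).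
      apply Dut; [apply Hmm; lra|easy]. }
  apply (is_derive_RInt_param (fun s x => u x s)).
  - apply Hloc; intros s Hs x Hx; exists (ut x s); apply Dut; auto.
  - intros x Hx; apply Hmm in Hx.
    apply continuity_2d_pt_ext_loc with (fun s y => ut y s).
    + assert (Hm : 0 < Rmin (Rmin (x - l) (r - x)) (Rmin (t - t0) (t1 - t))).
      { repeat apply Rmin_pos; lra. }
      exists (mkposreal _ Hm); simpl; intros s y Hs Hy.
      symmetry; apply is_derive_unique, Dut;
      revert Hy Hs; unfold Rmin; repeat destruct (Rle_dec _ _); intros Hy Hs;
        apply Rabs_def2 in Hy, Hs; lra.
    + intros eps.
      destruct (continuity_2d_pt_open_rectangle _ _ _ _ _ x t Cut Hx Ht eps)
        as (delta & H).
      exists delta; intros s y Hs Hy; now apply H.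
  - apply Hloc; intros s Hs; apply @ex_RInt_continuous; intros x Hx.
    apply @ex_derive_continuous; exists (ux x s); apply Dux; [auto|lra].
Qed.

(* The derivatives [ut] and [uxx] exist only in the open rectangle, so the
   balance of mass is taken on [[l + eta, r - eta]], with the flux there
   compared to the boundary data, and [eta] tends to [0]. *)
Lemma neumann_mass_balance a l r t0 t1 sl sr u0 u ux ut uxx :
  l < r -> t0 < t1 ->
  neumann_solution a l r t0 t1 sl sr u0 u ux ut uxx ->
  RInt (fun x => u x t1) l r = RInt u0 l r + (t1 - t0) * (a * (sr - sl)).
Proof.
  intros Hlr Ht HS.
  pose proof (fun x t => continuity_2d_pt_clamp u l r t0 t1 x t
    (Rlt_le _ _ Hlr) (Rlt_le _ _ Ht) (sol_cont _ _ _ _ _ _ _ _ _ _ _ _ HS)) as Hv.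
  pose proof (fun x t => continuity_2d_pt_clamp ux l r t0 t1 x t
    (Rlt_le _ _ Hlr) (Rlt_le _ _ Ht) (sol_ux_cont _ _ _ _ _ _ _ _ _ _ _ _ HS)) as Hw.
  set (v := fun x t => u (clamp l r x) (clamp t0 t1 t)) in *.
  set (w := fun x t => ux (clamp l r x) (clamp t0 t1 t)) in *.
  assert (Ev : forall x t, l <= x <= r -> t0 <= t <= t1 -> v x t = u x t).
  { intros x t Hx Hs; unfold v; now rewrite !clamp_id. }
  assert (Ew : forall x t, l <= x <= r -> t0 <= t <= t1 -> w x t = ux x t).
  { intros x t Hx Hs; unfold w; now rewrite !clamp_id. }
  assert (Iv : forall t x y, ex_RInt (fun x => v x t) x y).
  { intros t x y; apply @ex_RInt_continuous; intros z _.
    now apply continuity_2d_pt_continuous_1. }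
  (* For [x] in the box, [D x] is the mass gained in [[l, x]] from [t0] to [t1]. *)
  set (D := fun x => RInt (fun y => v y t1) l x - RInt (fun y => v y t0) l x).
  assert (DE : forall x y,
    D y - D x = RInt (fun z => v z t1) x y - RInt (fun z => v z t0) x y).
  { intros x y; unfold D.
    pose proof (RInt_Chasles (fun z => v z t1) l x y (Iv _ _ _) (Iv _ _ _)) as C1.
    pose proof (RInt_Chasles (fun z => v z t0) l x y (Iv _ _ _) (Iv _ _ _)) as C0.
    change plus with Rplus in C1, C0; lra. }
  assert (DC : forall x, continuous D x).
  { intros x; apply @ex_derive_continuous.
    exists (v x t1 - v x t0).
    assert (H : forall t, is_derive (fun x => RInt (fun y => v y t) l x) x (v x t)).
    { intros t; apply (is_derive_RInt (fun y => v y t) _ l).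
      - apply filter_forall; intros y; apply (RInt_correct (fun z => v z t)), Iv.
      - now apply continuity_2d_pt_continuous_1. }
    exact (is_derive_minus _ _ x _ _ (H t1) (H t0)). }
  (* [K eta] is the defect of the mass balance on the shrunken box. It is continuous at 0 and
     arbitrarily small for small positive [eta], hence [K 0 = 0]. *)
  set (K := fun eta => D (r - eta) - D (l + eta) - (t1 - t0) * (a * (sr - sl))).
  assert (KC : continuous K 0).
  { apply (continuous_minus (fun eta => D (r - eta) - D (l + eta)));
      [|apply continuous_const].
    apply (continuous_minus (fun eta => D (r - eta)) (fun eta => D (l + eta))).
    - apply (continuous_comp (fun eta => r - eta) D); [|apply DC].
      apply @ex_derive_continuous; auto_derive; easy.
    - apply (continuous_comp (fun eta => l + eta) D); [|apply DC].
      apply @ex_derive_continuous; auto_derive; easy. }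
  assert (KS : forall eps, 0 < eps -> exists delta, 0 < delta /\
    forall eta, 0 < eta < delta -> Rabs (K eta) <= eps).
  { intros eps Heps.
    pose proof (Rabs_pos a) as Ha.
    assert (Hm : 0 < (t1 - t0) * (Rabs a + 1)) by nra.
    (* The 2 accounts for the flux errors at the two ends, and the [+ 1] covers [a = 0]. *)
    assert (He : 0 < eps / (2 * ((t1 - t0) * (Rabs a + 1))))
      by (apply Rdiv_lt_0_compat; lra).
    destruct (uniform_continuity_2d w l r t0 t1 (fun x t _ _ => Hw x t)
      (mkposreal _ He)) as (delta & Hdelta).
    exists (Rmin delta ((r - l) / 2)); split.
    { apply Rmin_pos; [apply cond_pos|lra]. }
    intros eta Heta.
    pose proof (Rmin_l delta ((r - l) / 2)).
    pose proof (Rmin_r delta ((r - l) / 2)).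
    (* The mean value theorem asks for a derivative only at interior times, and for mere continuity
       of the mass at [t0] and [t1]. *)
    destruct (MVT_gen (fun t => RInt (fun x => v x t) (l + eta) (r - eta)) t0 t1
      (fun t => a * (ux (r - eta) t - ux (l + eta) t))) as (z & Hz & E).
    - intros t; rewrite Rmin_left, Rmax_right by lra; intros Hz.
      apply is_derive_ext_loc with
        (fun t => RInt (fun x => u x t) (l + eta) (r - eta)).
      + apply (locally_interval _ t t0 t1); simpl; try lra.
        intros s Hs1 Hs2; apply RInt_R_ext; intros x.
        rewrite Rmin_left, Rmax_right by lra; intros Hx.
        symmetry; apply Ev; simpl in *; lra.
      + eapply neumann_interior_flux; eauto; lra.
    - intros t _; apply continuity_pt_filterlim.
      apply (RInt_param_continuous v); [easy|lra].
    - rewrite Rmin_left, Rmax_right in Hz by lra.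
      unfold K; rewrite DE, E.
      assert (B : forall x y s, l <= x <= r -> l <= y <= r -> Rabs (y - x) < delta ->
        ux x z = s -> Rabs (ux y z - s) <= eps / (2 * ((t1 - t0) * (Rabs a + 1)))).
      { intros x y s Hx Hy Hxy <-; rewrite <- !Ew by lra; left.
        apply (Hdelta x z y z); try lra.
        rewrite Rminus_diag, Rabs_R0; apply cond_pos. }
      pose proof (B r (r - eta) sr ltac:(lra) ltac:(lra)
        ltac:(apply Rabs_def1; lra) (sol_right _ _ _ _ _ _ _ _ _ _ _ _ HS z Hz)) as Br.
      pose proof (B l (l + eta) sl ltac:(lra) ltac:(lra)
        ltac:(apply Rabs_def1; lra) (sol_left _ _ _ _ _ _ _ _ _ _ _ _ HS z Hz)) as Bl.
      replace (_ - _) with ((t1 - t0) * (a *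
        ((ux (r - eta) z - sr) + - (ux (l + eta) z - sl)))) by ring.
      rewrite !Rabs_mult, (Rabs_pos_eq (t1 - t0)) by lra.
      set (e := eps / (2 * ((t1 - t0) * (Rabs a + 1)))) in *.
      replace eps with ((t1 - t0) * ((Rabs a + 1) * (2 * e)))
        by (unfold e; field; lra).
      apply Rmult_le_compat_l; [lra|].
      apply Rmult_le_compat; [easy|apply Rabs_pos|lra|].
      eapply Rle_trans; [apply Rabs_triang|rewrite Rabs_Ropp; lra]. }
  assert (K0 : K 0 = 0).
  { apply Rabs_eq_0, Rle_antisym; [|apply Rabs_pos].
    apply Rnot_lt_le; intros Hpos.
    destruct (KS (Rabs (K 0) / 2) ltac:(lra)) as (d1 & Hd1 & H1).
    apply continuity_pt_filterlim in KC.
    destruct (KC (Rabs (K 0) / 2) ltac:(lra)) as (d2 & Hd2 & H2).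
    set (eta := Rmin d1 d2 / 2).
    assert (0 < Rmin d1 d2) by now apply Rmin_pos.
    pose proof (Rmin_l d1 d2); pose proof (Rmin_r d1 d2).
    specialize (H1 eta ltac:(unfold eta; lra)).
    assert (HK : Rabs (K eta - K 0) < Rabs (K 0) / 2).
    { apply H2; split; [split; [easy|unfold eta; lra]|].
      simpl; unfold Rdist; rewrite Rabs_pos_eq; unfold eta; lra. }
    rewrite Rabs_minus_sym in HK.
    pose proof (Rabs_triang_inv (K 0) (K eta)); lra. }
  unfold K in K0; rewrite Rminus_0_r, Rplus_0_r, DE in K0.
  assert (E1 : RInt (fun x => u x t1) l r = RInt (fun x => v x t1) l r).
  { apply RInt_R_ext; intros x; rewrite Rmin_left, Rmax_right by lra; intros Hx.
    symmetry; apply Ev; lra. }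
  assert (E0 : RInt u0 l r = RInt (fun x => v x t0) l r).
  { apply RInt_R_ext; intros x; rewrite Rmin_left, Rmax_right by lra; intros Hx.
    rewrite Ev by lra; symmetry; apply (sol_init _ _ _ _ _ _ _ _ _ _ _ _ HS); lra. }
  rewrite E1, E0; lra.
Qed.

(** * The gap-tooth step *)

(** The quadratic term has average [(sp - sm) / (2 * h) * (h ^ 2 / 12)], which is exactly what the
    constant term subtracts. *)
Lemma initial_profile_average h x0 v sm sp :
  h <> 0 -> box_average h x0 (initial_profile h x0 v sm sp) = v.
Proof.
  intros Hh; unfold box_average.
  set (F := fun x => (sp - sm) / (2 * h) * ((x - x0) ^ 3 / 3)
    + (sp + sm) / 2 * ((x - x0) ^ 2 / 2) + (v - h / 24 * (sp - sm)) * x).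
  assert (H : is_RInt (initial_profile h x0 v sm sp) (x0 - h / 2) (x0 + h / 2)
    (F (x0 + h / 2) - F (x0 - h / 2))).
  { apply (is_RInt_derive F).
    - intros x _; unfold F, initial_profile; auto_derive; [easy|field; easy].
    - intros x _; unfold initial_profile; apply @ex_derive_continuous.
      auto_derive; easy. }
  rewrite (is_RInt_unique _ _ _ _ H); unfold F; field; easy.
Qed.

Lemma continuous_continuous_on (D : R * R -> Prop) (F : R * R -> R) :
  (forall z, continuous F z) -> continuous_on D F.
Proof.
  intros HF z _.
  refine (filterlim_filter_le_1 _ (filter_le_within (F := locally z) D) _).
  apply HF.
Qed.

Lemma continuous_ex_derive_comp (f : R -> R) (g : R * R -> R) z :
  (forall x, ex_derive f x) -> continuous g z -> continuous (fun y => f (g y)) z.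
Proof.
  intros Hf Hg; apply (continuous_comp g f); [easy|].
  apply @ex_derive_continuous, Hf.
Qed.

(* The second derivative of a quadratic profile is constant, so the profile
   rises uniformly and keeps its boundary slopes. *)
Lemma quadratic_neumann_solution a h x0 t0 t1 v sm sp :
  h <> 0 ->
  neumann_solution a (x0 - h / 2) (x0 + h / 2) t0 t1 sm sp
    (initial_profile h x0 v sm sp)
    (fun x t => initial_profile h x0 v sm sp x + a * ((sp - sm) / h) * (t - t0))
    (fun x t => (sp - sm) / h * (x - x0) + (sp + sm) / 2)
    (fun _ _ => a * ((sp - sm) / h)) (fun _ _ => (sp - sm) / h).
Proof.
  intros Hh; constructor.
  - apply continuous_continuous_on; intros z.
    apply (continuous_plus (fun z : R * R => initial_profile h x0 v sm sp (fst z))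
      (fun z : R * R => a * ((sp - sm) / h) * (snd z - t0))).
    + apply continuous_ex_derive_comp; [|apply continuous_fst].
      intros x; unfold initial_profile; auto_derive; easy.
    + apply (continuous_ex_derive_comp (fun t => a * ((sp - sm) / h) * (t - t0)));
        [|apply continuous_snd].
      intros t; auto_derive; easy.
  - apply continuous_continuous_on; intros z.
    apply (continuous_ex_derive_comp
      (fun x => (sp - sm) / h * (x - x0) + (sp + sm) / 2)); [|apply continuous_fst].
    intros x; auto_derive; easy.
  - intros z _; apply filterlim_const.
  - intros z _; apply filterlim_const.
  - intros x t _ _; unfold initial_profile; auto_derive; [easy|field; easy].
  - intros x t _ _; auto_derive; [easy|ring].
  - intros x t _ _; auto_derive; [easy|field; easy].
  - easy.
  - intros t _; field; easy.
  - intros t _; field; easy.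
  - intros x _; ring.
Qed.

Lemma mesh_add dx i j : mesh dx (i + j) = mesh dx i + IZR j * dx.
Proof. unfold mesh; rewrite plus_IZR; ring. Qed.

(** Interpolate the data as point values at the mesh points, then take a preimage of this polynomial
    under averaging. *)
Lemma interpolates_averages_exist k h dx V i :
  h <> 0 -> dx <> 0 -> exists p, interpolates_averages k h dx V i p.
Proof.
  intros Hh Hdx.
  destruct (interpolation (S k) (fun l => mesh dx (i + stencil k l))
    (fun l => V (i + stencil k l)%Z)) as (q & Hq & E).
  { intros l m Hl H; unfold mesh in H; apply Rmult_eq_reg_r in H; [|easy].
    apply eq_IZR, Z.add_cancel_l, stencil_injective in H; lia. }
  destruct (centred_moment_surjective h (S k) q Hh Hq) as (p & Hp & Ep).
  exists p; split; [now apply polynomial_of_degree_poly|]; intros l Hl.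
  rewrite (centred_moment_0 h (S k)), Ep by easy; apply E; lia.
Qed.

(** The box average is [/ h] times the increment across the box of an antiderivative [Q] of [p]. *)
Lemma is_derive_centred_moment h n p x :
  poly n p ->
  is_derive (centred_moment h 0 p) x (/ h * (p (x + h / 2) - p (x - h / 2))).
Proof.
  intros Hp; set (Q := fun y => RInt p 0 y).
  assert (DQ : forall y, is_derive Q y (p y)).
  { intros y; apply (is_derive_RInt p Q 0).
    - apply filter_forall; intros z; apply (RInt_correct p).
      now apply (poly_ex_RInt n).
    - now apply (poly_continuous n). }
  apply is_derive_ext with (fun x => / h * (Q (x + h / 2) - Q (x - h / 2))).
  - intros t; rewrite <- (centred_moment_0 h n) by easy.
    unfold box_average, Q; f_equal.
    pose proof (RInt_Chasles p 0 (t - h / 2) (t + h / 2)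
      (poly_ex_RInt n _ _ _ Hp) (poly_ex_RInt n _ _ _ Hp)) as C.
    change plus with Rplus in C; lra.
  - auto_derive; [split; [eexists; apply DQ|split; [eexists; apply DQ|easy]]|].
    change (fun x => Q x) with Q; rewrite !(is_derive_unique _ _ _ (DQ _)).
    unfold Rminus; ring.
Qed.

(* The box average of [p] is a polynomial interpolating [V] at the mesh points;
   its second derivative is the difference quotient of [p'] over the box. *)
Lemma central_difference_interpolant k c h dx V i p :
  Nat.Even k -> order_central_weights k c -> h <> 0 -> dx <> 0 ->
  interpolates_averages k h dx V i p ->
  central_difference k c dx V i
  = (Derive p (mesh dx i + h / 2) - Derive p (mesh dx i - h / 2)) / h.
Proof.
  intros Hk Hc Hh Hdx [Hp HV].
  apply polynomial_of_degree_poly in Hp.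
  (* In the variable [s] the stencil consists of integers; differentiating twice in [s] yields the
     factor [dx ^ 2] that cancels the one in the central difference. *)
  set (g := fun s => centred_moment h 0 p (mesh dx i + s * dx)).
  assert (Hg : poly (S k) g).
  { apply (poly_comp_affine _ (centred_moment h 0 p)), poly_centred_moment, Hp. }
  destruct (poly_derive (S k) p Hp) as (dp & _ & Dp).
  set (g1 := fun s => dx * (/ h *
    (p (mesh dx i + s * dx + h / 2) - p (mesh dx i + s * dx - h / 2)))).
  assert (D1 : forall s, is_derive g s (g1 s)).
  { intros s.
    pose proof (is_derive_centred_moment h (S k) p (mesh dx i + s * dx) Hp) as D.
    unfold g, g1; auto_derive; [now eexists; apply D|].
    change (fun x => centred_moment h 0 p x) with (centred_moment h 0 p).
    rewrite (is_derive_unique _ _ _ D); ring. }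
  assert (D2 : is_derive g1 0 (dx ^ 2 *
    ((Derive p (mesh dx i + h / 2) - Derive p (mesh dx i - h / 2)) / h))).
  { unfold g1; auto_derive.
    - repeat split; eexists; apply Dp.
    - change (fun x => p x) with p.
      replace (mesh dx i + 0 * dx + h / 2) with (mesh dx i + h / 2) by ring.
      replace (mesh dx i + 0 * dx + - (h / 2)) with (mesh dx i - h / 2) by ring.
      field; easy. }
  pose proof (order_central_weights_exact k c g Hk Hc Hg) as E.
  assert (E2 : Derive_n g 2 0 = dx ^ 2 *
    ((Derive p (mesh dx i + h / 2) - Derive p (mesh dx i - h / 2)) / h)).
  { rewrite <- (is_derive_unique _ _ _ D2); simpl; apply Derive_ext; intros s.
    apply is_derive_unique, D1. }
  unfold central_difference.
  rewrite (sum_n_R_ext _ (fun l => c (stencil k l) * g (IZR (stencil k l)))).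
  - rewrite E, E2; field; split; easy.
  - intros l Hl; f_equal; unfold g.
    rewrite <- (centred_moment_0 h (S k)), <- mesh_add by easy.
    symmetry; now apply HV.
Qed.

Theorem theorem1 (k : nat) (k_even : Nat.Even k) :
  (exists c : Z -> R, order_central_weights k c) /\
  forall c : Z -> R, order_central_weights k c ->
  forall (N : nat) (a h dx dt : R),
    (0 < N)%nat -> dx = / INR N -> 0 < a -> 0 < h < dx -> 0 < dt ->
  forall (U : nat -> Z -> R) (n : nat) (i : Z),
    (Z.of_nat (k / 2) <= i)%Z -> (i + Z.of_nat (k / 2) <= Z.of_nat N)%Z ->
    (gap_tooth_update k a h dx dt U n i <->
     euler_central_update k c a dx dt U n i).
Proof.
  split; [now apply order_central_weights_exist|].
  intros c Hc N a h dx dt _ _ _ [Hh Hdx] Hdt U n i _ _.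
  assert (Ht : INR (S n) * dt - INR n * dt = dt) by (rewrite S_INR; ring).
  unfold euler_central_update.
  (* Stated for every interpolant and every solution, so that the same formula serves both
     directions of the equivalence. *)
  assert (Step : forall p u ux ut uxx,
    interpolates_averages k h dx (U n) i p ->
    neumann_solution a (mesh dx i - h / 2) (mesh dx i + h / 2)
      (INR n * dt) (INR (S n) * dt)
      (Derive p (mesh dx i - h / 2)) (Derive p (mesh dx i + h / 2))
      (initial_profile h (mesh dx i) (U n i)
        (Derive p (mesh dx i - h / 2)) (Derive p (mesh dx i + h / 2)))
      u ux ut uxx ->
    box_average h (mesh dx i) (fun x => u x (INR (S n) * dt))
    = U n i + dt * (a * central_difference k c dx (U n) i)).
  { intros p u ux ut uxx Hp HS.
    rewrite (central_difference_interpolant k c h dx (U n) i p) by (trivial; lra).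
    apply neumann_mass_balance in HS; [|lra|lra].
    unfold box_average; rewrite HS, Ht, Rmult_plus_distr_l.
    f_equal; [apply initial_profile_average; lra|field; lra]. }
  split.
  - intros (p & Hp & u & ux & ut & uxx & HS & ->).
    now apply (Step p u ux ut uxx).
  - intros HU.
    destruct (interpolates_averages_exist k h dx (U n) i) as (p & Hp); [lra..|].
    assert (Hh0 : h <> 0) by lra.
    pose proof (quadratic_neumann_solution a h (mesh dx i) (INR n * dt)
      (INR (S n) * dt) (U n i) (Derive p (mesh dx i - h / 2))
      (Derive p (mesh dx i + h / 2)) Hh0) as HS.
    exists p; split; [easy|].
    do 4 eexists; split; [exact HS|].
    rewrite HU; symmetry; exact (Step p _ _ _ _ Hp HS).
Qed.
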